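(* Consider minimizing $F(x)=\frac{f(x)+h(x)}{g(x)}$ over $\mathbb{R}^n$, with $f,h,g$ as in the context and $g$ concave and differentiable. Let $\theta>0$ and let $\{x^t\}$ be generated by FCD or PCD with uniformly random coordinate selection. For any global optimal solution $\bar x$ of the problem, define $q^t=F(x^t)-F(\bar x)$, $r^t=\frac12\|x^t-\bar x\|_{\bar c}^2$, and $\bar c=c+\theta$ (entrywise, i.e. $\bar c_i=c_i+\theta$). Then for all $t\ge 1$: (i) For FCD, $\displaystyle \mathbb{E}_{\xi^{t-1}}[q^t]\le\frac{n(\bar g\,\sigma\,q^0+r^0)}{g(\bar x)\,t}$, where $\sigma=\frac{\max(c)+\theta}{\theta}$. (ii) For PCD, $\displaystyle \mathbb{E}_{\xi^{t-1}}[q^t]\le\frac{n(\bar g\,q^0+r^0)}{g(\bar x)\,(t+1)}$.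
   Context: Standing assumptions. $F$ takes only finite values, with $f(x)+h(x)\ge 0$ and $g(x)>0$ for all $x$. The function $f$ is convex and differentiable, and there is $c\in\mathbb{R}^n$ with $c_i\ge 0$ such that $f(x+\eta e_i)\le f(x)+\nabla_i f(x)\eta+\frac{c_i}{2}\eta^2$ for all $x\in\mathbb{R}^n$, $\eta\in\mathbb{R}$, $i=1,\dots,n$ ($e_i$ is the $i$-th standard basis vector). The function $h$ is convex and separable: $h(x)=\sum_{i=1}^n h_i(x_i)$. There is a constant $\bar g>0$ with $g(x)\le\bar g$ for all $x\in\{z:F(z)\le F(x^0)\}$. The one-dimensional subproblems below are assumed to be globally solvable. Notation. $\|d\|_{\bar c}^2=\sum_i\bar c_i d_i^2$; $\max(c)=\max_i c_i$; $\xi^{t-1}=\{i^0,i^1,\dots,i^{t-1}\}$ are the random coordinates selected before $x^t$ is formed, and $\mathbb{E}_{\xi^{t-1}}$ is expectation over them. Let $\mathcal{J}_i(x,\eta)=f(x)+\nabla_i f(x)\eta+\frac{c_i+\theta}{2}\eta^2+h(x+\eta e_i)$. Algorithms. Starting from $x^0$, at iteration $t=0,1,2,\dots$ a coordinate $i^t\in\{1,\dots,n\}$ is chosen uniformly at random, a global minimizer $\bar\eta^t$ is computed, and $x^{t+1}=x^t+\bar\eta^t e_{i^t}$. In FCD, $\bar\eta^t\in\arg\min_\eta\frac{\mathcal{J}_{i^t}(x^t,\eta)}{g(x^t+\eta e_{i^t})}$; in PCD, $\bar\eta^t\in\arg\min_\eta\big[\mathcal{J}_{i^t}(x^t,\eta)-F(x^t)\,g(x^t+\eta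 e_{i^t})\big]$. *)

(* Defs.v *)
From HB Require Import structures.
From mathcomp Require Import all_boot all_order all_algebra.
From mathcomp Require Import all_classical all_reals all_analysis.

Set Implicit Arguments.
Unset Strict Implicit.
Unset Printing Implicit Defensive.

Import Order.TTheory GRing.Theory Num.Theory.
Import numFieldNormedType.Exports.

Local Open Scope classical_set_scope.
Local Open Scope ring_scope.

Section Vectors.
Context {R : realType} {n : nat}.
Implicit Types (f : 'rV[R]_n -> R) (x c d : 'rV[R]_n).

Definition basis_vec (i : 'I_n) : 'rV[R]_n := delta_mx 0 i.

Definition partial_deriv f (i : 'I_n) x : R := 'D_(basis_vec i) f x.

Definition convex_on_Rn f : Prop := convex_function [set: 'rV[R]_n] f.

Definition concave_on_Rn f : Prop := convex_on_Rn (fun x => - f x).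

Definition separable f : Prop :=
  exists fi : 'I_n -> R -> R, forall x, f x = \sum_(i < n) fi i (x 0 i).

Definition coordinate_smooth f c : Prop :=
  forall x (eta : R) (i : 'I_n),
    f (x + eta *: basis_vec i)
      <= f x + partial_deriv f i x * eta + c 0 i / 2 * eta ^+ 2.

Definition sqnorm_w c d : R := \sum_(i < n) c 0 i * d 0 i ^+ 2.

(* The unit 0 of this maximum is harmless: it is used for nonnegative c. *)
Definition max_entry c : R := \big[Num.max/0]_(i < n) c 0 i.

Definition frac_obj (f h g : 'rV[R]_n -> R) x : R := (f x + h x) / g x.

Definition global_minimizer {A : Type} (F : A -> R) (a : A) : Prop :=
  forall b, F a <= F b.

Definition major f (h : 'rV[R]_n -> R) c (theta : R) (i : 'I_n) x (eta : R) : R :=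
  f x + partial_deriv f i x * eta + (c 0 i + theta) / 2 * eta ^+ 2
    + h (x + eta *: basis_vec i).

Definition fcd_subproblem f (h g : 'rV[R]_n -> R) c (theta : R)
    (i : 'I_n) x (eta : R) : R :=
  major f h c theta i x eta / g (x + eta *: basis_vec i).

Definition pcd_subproblem f (h g : 'rV[R]_n -> R) c (theta : R)
    (i : 'I_n) x (eta : R) : R :=
  major f h c theta i x eta - frac_obj f h g x * g (x + eta *: basis_vec i).

End Vectors.

Section Randomness.
Context {R : realType} {n : nat} {d : measure_display} {Omega : measurableType d}.

(* Independent, uniformly distributed coordinates; 'I_n carries the discrete
   sigma-algebra, so every subset is an event and independence is the product
   rule over every finite set of times (listed without repetition by s). *)
Definition iid_uniform (P : probability Omega R) (I : nat -> Omega -> 'I_n)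
    : Prop :=
  [/\ forall t (A : set 'I_n), measurable (I t @^-1` A),
      forall t (i : 'I_n), P (I t @^-1` [set i]) = (n%:R^-1)%:E
    & forall (s : seq nat) (A : nat -> set 'I_n), uniq s ->
        P (\bigcap_(t in [set` s]) (I t @^-1` A t))
          = (\prod_(t <- s) P (I t @^-1` A t))%E ].

(* The iterates form the process X on Omega; along every sample path each step
   length is some global minimizer of the one-dimensional subproblem. *)
Definition coord_descent_run (subproblem : 'I_n -> 'rV[R]_n -> R -> R)
    (x0 : 'rV[R]_n) (I : nat -> Omega -> 'I_n)
    (X : nat -> Omega -> 'rV[R]_n) : Prop :=
  forall w, X 0%N w = x0 /\
    forall t, exists2 eta : R,
      global_minimizer (subproblem (I t w) (X t w)) eta
      & X t.+1 w = X t w + eta *: basis_vec (I t w).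

End Randomness.

(* Main.v *)
Require Import Defs.
From HB Require Import structures.
From mathcomp Require Import all_boot all_order all_algebra.
From mathcomp Require Import all_classical all_reals all_analysis.
From mathcomp Require Import ring lra.

(** A positive concave function on the whole of R^n is constant, so F is a
    positive multiple of the convex function G = f + h, and both FCD and PCD are
    the same randomized coordinate descent on G. The model minimized at each
    step is strongly convex, hence its minimizer is unique: the iterate X t is a
    function of the word of the first t coordinates, which is uniformly
    distributed. With r the weighted half squared distance to the optimum and q the
    gap of G, averaging over the coordinate gives
      E[r(x+) + q(x+)] <= r(x) + (1 - 1/n) q(x),
    and since E[q] is nonincreasing, summing this over time gives
    (t+1)/n E[q^t] <= r^0 + q^0. Dividing by the constant g <= gbar yields (ii),
    and (i) is weaker as sigma >= 1. *)

Import Order.TTheory GRing.Theory Num.Theory.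
Import numFieldNormedType.Exports.

Local Open Scope classical_set_scope.
Local Open Scope ring_scope.

(** Elementary form of letting [s] tend to 0 in a convexity inequality. *)
Lemma ler_shrinking (R : realFieldType) (a b : R) :
  (forall s, 0 < s -> s < 1 -> (1 - s) * b <= a) -> b <= a.
Proof.
move=> ab; rewrite leNgt; apply/negP => ltab.
have [a0|a0] := ltP a 0.
  by have := ab (1 / 2) ltac:(lra) ltac:(lra); lra.
have b0 : 0 < b by lra.
set s := (b - a) / (2 * b).
have sE : s * b = (b - a) / 2 by rewrite /s; field; lra.
have s0 : 0 < s by rewrite divr_gt0//; lra.
have s1 : s < 1 by rewrite ltr_pdivrMr; nra.
by have := ab s s0 s1; lra.
Qed.

(** * Convex and concave functions on R^n *)

Section Convexity.
Context {R : realType} {n : nat}.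
Implicit Types (f h g : 'rV[R]_n -> R) (x y v c : 'rV[R]_n).

Lemma convex_onP f : convex_on_Rn f -> forall x y (s : R), 0 <= s -> s <= 1 ->
  f (x + s *: (y - x)) <= (1 - s) * f x + s * f y.
Proof.
move=> cf x y s s0 s1.
have s0' : 0 <= 1 - s by rewrite subr_ge0.
have s1' : 1 - s <= 1 by rewrite gerBl.
have := cf (Itv01 s0' s1') x y (mem_set I) (mem_set I).
rewrite convRE /=.
rewrite /conv/= /unstable.onem opprB addrCA subrr addr0.
suff -> : (1 - s) *: x + s *: y = x + s *: (y - x) by [].
by rewrite scalerBl scale1r scalerBr addrAC addrA.
Qed.

(** [y] lies between [x] and the far point [x + s^-1 (y - x)]; as [g] is positive there, concavity
    gives [(1 - s) * g x <= g y]. *)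
Lemma concave_gt0_const g : concave_on_Rn g -> (forall x, 0 < g x) ->
  forall x y, g x = g y.
Proof.
move=> cg g0.
suff le x y : g x <= g y by move=> x y; apply/eqP; rewrite eq_le !le.
apply: ler_shrinking => s s_gt0 s_lt1.
have := convex_onP _ cg x (x + s^-1 *: (y - x)) s (ltW s_gt0) (ltW s_lt1).
rewrite [_ + _ - x]addrC addKr scalerA divff ?gt_eqF// scale1r [x + _]addrC subrK.
by have := g0 (x + s^-1 *: (y - x)); nra.
Qed.

(** Gradient inequality: the difference quotients along [v] with [0 < s < 1] are at most
    [f (x + v) - f x], hence so is their limit. *)
Lemma convex_partial_deriv_le f x v : convex_on_Rn f -> differentiable f x ->
  f x + \sum_(i < n) partial_deriv f i x * v 0 i <= f (x + v).
Proof.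
move=> cf df.
have -> : \sum_(i < n) partial_deriv f i x * v 0 i = 'D_v f x.
  rewrite deriveE// [in RHS](row_sum_delta v) linear_sum; apply: eq_bigr => i _.
  by rewrite linearZ /= /partial_deriv deriveE// mulrC.
suff: 'D_v f x <= f (x + v) - f x by lra.
have /cvg_dnbhs_at_right dv := diff_derivable (v := v) df.
apply: (cvgr_to_le dv); near=> s.
have s0 : 0 < s by near: s; exact: nbhs_right_gt.
have s1 : s < 1 by near: s; exact: nbhs_right_lt.
rewrite /= /shift /= /GRing.scale /= mulrC ler_pdivrMr//.
have := convex_onP _ cf x (x + v) s (ltW s0) (ltW s1).
rewrite [x + v - x]addrC addKr [x + _]addrC; nra.
Unshelve. all: by end_near. Qed.

(** * The strongly convex coordinate model *)

Context {f h : 'rV[R]_n -> R} {c : 'rV[R]_n} {theta : R}.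
Hypotheses (h_convex : convex_on_Rn h) (theta_gt0 : 0 < theta).
Hypothesis c_ge0 : forall i, 0 <= c 0 i.

Local Notation Jmin i x := (global_minimizer (major f h c theta i x)).

(** The point [eta + s (eta' - eta)] is no better than [eta], yet lies below the chord by at least
    [s (1 - s)] times the quadratic term; divide by [s] and let [s] tend to 0. *)
Lemma major_strongly_convex i x eta : Jmin i x eta -> forall eta',
  major f h c theta i x eta + (c 0 i + theta) / 2 * (eta' - eta) ^+ 2
    <= major f h c theta i x eta'.
Proof.
move=> Jeta eta'.
suff: (c 0 i + theta) / 2 * (eta' - eta) ^+ 2 <=
    major f h c theta i x eta' - major f h c theta i x eta by lra.
apply: ler_shrinking => s s0 s1.
have := Jeta (eta + s * (eta' - eta)).
have := convex_onP _ h_convex (x + eta *: basis_vec i) (x + eta' *: basis_vec i)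
  s (ltW s0) (ltW s1).
have -> : x + eta *: basis_vec i + s *: (x + eta' *: basis_vec i -
    (x + eta *: basis_vec i)) = x + (eta + s * (eta' - eta)) *: basis_vec i.
  by rewrite opprD addrACA subrr add0r -scalerBl scalerA -addrA -scalerDl.
rewrite /major; set H := h _; set H0 := h _; set H1 := h _.
move=> Hle Jle.
rewrite -(ler_pM2l s0); set k := (c 0 i + theta) / 2.
move: Hle Jle; rewrite -/k; nra.
Qed.

Lemma major_minimizer_unique i x eta eta' :
  Jmin i x eta -> Jmin i x eta' -> eta = eta'.
Proof.
move=> Jeta Jeta'; apply/eqP.
rewrite -subr_eq0 -sqrf_eq0 eq_le sqr_ge0 andbT.
have k0 : 0 < (c 0 i + theta) / 2 by rewrite divr_gt0// ltr_wpDl.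
rewrite -(pmulr_rle0 _ k0).
by have := major_strongly_convex _ _ _ Jeta' eta; have := Jeta eta'; lra.
Qed.

(** For constant [g], the FCD quotient is a positive multiple of the model and the PCD difference a
    translate of it. *)
Lemma fcd_minimizerE g i x eta : (forall y, 0 < g y) -> (forall y z, g y = g z) ->
  global_minimizer (fcd_subproblem f h g c theta i x) eta = Jmin i x eta.
Proof.
move=> g0 gE; apply/propext; split=> m eta'; have := m eta';
  by rewrite /fcd_subproblem (gE _ x) (gE (_ + eta' *: _) x) ler_pM2r ?invr_gt0.
Qed.

Lemma pcd_minimizerE g i x eta : (forall y z, g y = g z) ->
  global_minimizer (pcd_subproblem f h g c theta i x) eta = Jmin i x eta.
Proof.
move=> gE; apply/propext; split=> m eta'; have := m eta';
  by rewrite /pcd_subproblem (gE _ x) (gE (_ + eta' *: _) x) lerD2r.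
Qed.

(** * One-step descent of objective and distance *)

Hypotheses (f_convex : convex_on_Rn f) (f_diff : forall x, differentiable f x).
Hypotheses (f_smooth : coordinate_smooth f c) (h_separable : separable h).

Local Notation G x := (f x + h x).
Let cbar : 'rV[R]_n := \row_(i < n) (c 0 i + theta).

Lemma obj_le_major i x eta :
  G (x + eta *: basis_vec i) <= major f h c theta i x eta.
Proof.
have := f_smooth x eta i; rewrite /major.
have : 0 <= theta * eta ^+ 2 by rewrite mulr_ge0 ?sqr_ge0 ?ltW.
lra.
Qed.

Lemma obj_minimizer_le i x eta : Jmin i x eta -> G (x + eta *: basis_vec i) <= G x.
Proof.
move=> Jeta; apply: le_trans (obj_le_major _ _ _) _.
(* The zero step has model value [f x + h x]. *)
have := Jeta 0; rewrite {2}/major scale0r addr0; lra.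
Qed.

(** The [i]-th shifted point agrees with [y] in coordinate [i] and with [x] elsewhere, so only one
    summand of [h] changes. *)
Lemma separable_sum_shift x y :
  \sum_(i < n) (h (x + (y 0 i - x 0 i) *: basis_vec i) - h x) = h y - h x.
Proof.
have [fi hE] := h_separable; rewrite !hE -sumrB; apply: eq_bigr => i _.
rewrite hE -sumrB (bigD1 i)//= big1 ?addr0 => [|j ji].
  by rewrite !mxE !eqxx mulr1 addrCA subrr addr0.
by rewrite !mxE (negPf ji) andbF mulr0 addr0 subrr.
Qed.

Lemma sqnorm_w_shift (w : 'rV[R]_n) i x y eta :
  sqnorm_w w (x + eta *: basis_vec i - y) =
  sqnorm_w w (x - y) + w 0 i * (x 0 i + eta - y 0 i) ^+ 2
    - w 0 i * (x 0 i - y 0 i) ^+ 2.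
Proof.
rewrite /sqnorm_w (bigD1 i)//= [in RHS](bigD1 i)//= !mxE !eqxx mulr1.
rewrite (eq_bigr (fun j => w 0 j * (x - y) 0 j ^+ 2)) => [|j ji]; first by ring.
by rewrite !mxE (negPf ji) andbF mulr0 addr0.
Qed.

(* Compare the minimizer [eta i] with the trial step [xb 0 i - x 0 i]: strong
   convexity of the model produces exactly the change of the weighted distance
   to [xb], and the linear and separable parts sum up to a bound by [G xb]. *)
Lemma sum_dist_obj_descent x xb (eta : 'I_n -> R) :
  (forall i, Jmin i x (eta i)) ->
  \sum_(i < n) (2^-1 * sqnorm_w cbar (x + eta i *: basis_vec i - xb)
                + G (x + eta i *: basis_vec i))
    <= n%:R * (2^-1 * sqnorm_w cbar (x - xb)) + (n%:R - 1) * G x + G xb.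
Proof.
move=> Jeta.
have step i : 2^-1 * sqnorm_w cbar (x + eta i *: basis_vec i - xb)
                + G (x + eta i *: basis_vec i) <=
    2^-1 * sqnorm_w cbar (x - xb) + G x + partial_deriv f i x * (xb - x) 0 i
      + (h (x + (xb 0 i - x 0 i) *: basis_vec i) - h x).
  have := major_strongly_convex _ _ _ (Jeta i) (xb 0 i - x 0 i).
  have := obj_le_major i x (eta i).
  rewrite sqnorm_w_shift [major _ _ _ _ _ _ (_ - _)]/major !mxE.
  by lra.
apply: le_trans; first by apply: ler_sum => i _; exact: step.
rewrite big_split /= separable_sum_shift big_split /= sumr_const card_ord.
have := convex_partial_deriv_le f x (xb - x) f_convex (f_diff x).
rewrite [x + (xb - x)]addrC subrK -mulr_natl; lra.
Qed.

End Convexity.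

(** * Sublinear rate from a recursion *)

Lemma descent_rate (R : realFieldType) (a b : nat -> R) (k : R) :
  k <= 1 -> (forall t, 0 <= a t) -> (forall t, 0 <= b t) ->
  0 <= k -> (forall t, a t.+1 <= a t) ->
  (forall t, b t.+1 + a t.+1 <= b t + (1 - k) * a t) ->
  forall t, t.+1%:R * (k * a t) <= b 0%N + a 0%N.
Proof.
move=> k1 a0 b0 k0 amono step t.
(* By monotonicity the first term grows by at most [k * a t] per step, no more than [b t + a t]
   loses. *)
have acc : t%:R * (k * a t) + (b t + a t) <= b 0%N + a 0%N.
  elim: t => [|t IH]; first by rewrite mul0r add0r.
  apply: le_trans IH; have := step t.
  have : t.+1%:R * (k * a t.+1) <= t.+1%:R * (k * a t).
    by rewrite ler_wpM2l// ler_wpM2l.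
  by rewrite -natr1; lra.
(* The leftover [a t] pays for one more [k * a t], whence [t.+1] rather than [t]. *)
have : k * a t <= a t by rewrite ler_piMl.
by have := b0 t; rewrite -natr1; lra.
Qed.

(** * Words of random coordinates *)

Lemma sum_tuple_rcons (T : finType) (V : nmodType) t (phi : seq T -> V) :
  \sum_(u : t.+1.-tuple T) phi u = \sum_(u : t.-tuple T) \sum_i phi (rcons u i).
Proof.
rewrite pair_big/=.
(* Appending a last letter is injective, hence bijective by counting. *)
have inj : injective (fun p : t.-tuple T * T => [tuple of rcons p.1 p.2]).
  by move=> [u i] [v j] /(congr1 val)/rcons_inj[/val_inj -> ->].
rewrite (reindex _ (onW_bij _ (inj_card_bij inj _)))//.
by rewrite card_prod !card_tuple expnSr.
Qed.

Definition history {n : nat} {Omega : Type} (I : nat -> Omega -> 'I_n) (t : nat)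
  (w : Omega) : seq 'I_n := mkseq (I^~ w) t.

Section Words.
Context {R : realType} {n : nat} {d : measure_display} {Omega : measurableType d}.
Context {P : probability Omega R} {I : nat -> Omega -> 'I_n}.
Hypothesis I_iid : iid_uniform P I.

Let history_event (u : seq 'I_n) : set Omega := history I (size u) @^-1` [set u].

(** [i0] is only the default of [nth]; below it is the head of a nonempty word, and the empty word
    is treated apart. *)
Let history_eventE i0 u : history_event u =
  \bigcap_(t in [set` iota 0 (size u)]) (I t @^-1` [set nth i0 u t]).
Proof.
apply/seteqP; split=> w.
  move=> /= uE t /=; rewrite mem_iota/= add0n => tu.
  by rewrite -[in RHS]uE nth_mkseq.
move=> wu; apply: (@eq_from_nth _ i0); rewrite size_mkseq// => t tu.
by rewrite nth_mkseq//; apply: wu; rewrite /= mem_iota.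
Qed.

Lemma measurable_history_event u : measurable (history_event u).
Proof.
have [mI _ _] := I_iid; case: u => [|i0 u].
  by rewrite (_ : history_event _ = setT)// -subTset.
by rewrite (history_eventE i0); apply: bigcap_measurableType => k _; exact: mI.
Qed.

Lemma probability_history_event u :
  P (history_event u) = (n%:R^-1 ^+ size u)%:E.
Proof.
have [_ PI indep] := I_iid; case: u => [|i0 u].
  by rewrite (_ : history_event _ = setT) ?probability_setT// -subTset.
rewrite (history_eventE i0) indep ?iota_uniq//.
under eq_bigr do rewrite PI.
by rewrite prodEFin big_const_seq count_predT size_iota iter_mulr_1.
Qed.

(** The event of [u] has positive probability: [n > 0] as soon as [u] has a letter, and the empty
    word has probability 1. *)
Lemma history_realized u : exists w, history I (size u) w = u.
Proof.
apply: contrapT => nou.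
have u0 : history_event u = set0 by rewrite -subset0 => w uw; apply: nou; exists w.
have := probability_history_event u; rewrite u0 measure0 => /esym/eqP.
rewrite eqe expf_eq0 invr_eq0 pnatr_eq0.
case: u {nou u0} => [//|i u].
by rewrite (gtn_eqF (leq_ltn_trans (leq0n i) (ltn_ord i))) andbF.
Qed.

(** The variable is a finite combination of indicators of history events; nonnegativity lets the
    integral pass through the sum. *)
Lemma expectation_history (psi : seq 'I_n -> R) t : (forall u, 0 <= psi u) ->
  ('E_P[fun w => psi (history I t w)])%E
    = (n%:R^-1 ^+ t * \sum_(u : t.-tuple 'I_n) psi u)%:E.
Proof.
move=> psi0.
have psiE w : (psi (history I t w))%:E =
    (\sum_(u : t.-tuple 'I_n) (psi u * \1_(history_event u) w)%:E)%E.
  have sz : size (history I t w) == t by rewrite size_mkseq.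
  rewrite (bigD1 (Tuple sz))//= big1 ?adde0 => [|u uw].
    by rewrite indicE mem_set ?mulr1//= /history_event /= size_mkseq.
  rewrite indicE memNset ?mulr0// /history_event /= size_tuple => wu.
  by move/eqP: uw; apply; apply/val_inj; rewrite /= wu.
rewrite unlock (eq_integral _ _ (fun w _ => psiE w)) ge0_integral_sum//=; last 2 first.
- move=> u; apply/measurable_realfun.measurable_EFinP.
  apply: measurable_realfun.measurable_funM => //.
  exact/measurable_realfun.measurable_indic/measurable_history_event.
- by move=> u w _; rewrite lee_fin mulr_ge0.
have int (u : t.-tuple 'I_n) :
    (\int[P]_w (psi u * \1_(history_event u) w)%:E)%E = (psi u * n%:R^-1 ^+ t)%:E.
  have mu := measurable_history_event u.
  rewrite (integralZl_indic _ (fun=> history_event u)) ?integral_indic ?setIT//.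
    by have := probability_history_event u; rewrite size_tuple EFinM => <-.
  by rewrite ltNge psi0.
rewrite (eq_bigr _ (fun u _ => int u)) sumEFin mulr_sumr.
by congr EFin; apply: eq_bigr => u _; rewrite mulrC.
Qed.

End Words.

(** * Rate of randomized coordinate descent on [f + h] *)

Section Rate.
Context {R : realType} {n : nat} {f h : 'rV[R]_n -> R} {c : 'rV[R]_n}.
Context {theta : R} {xb x0 : 'rV[R]_n}.
Context {d : measure_display} {Omega : measurableType d}.
Context {P : probability Omega R}.
Context {I : nat -> Omega -> 'I_n} {X : nat -> Omega -> 'rV[R]_n}.
Hypotheses (f_convex : convex_on_Rn f) (f_diff : forall x, differentiable f x).
Hypotheses (c_ge0 : forall i, 0 <= c 0 i) (f_smooth : coordinate_smooth f c).
Hypotheses (h_convex : convex_on_Rn h) (h_separable : separable h).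
Hypotheses (theta_gt0 : 0 < theta) (I_iid : iid_uniform P I).
Hypothesis X_run : coord_descent_run (major f h c theta) x0 I X.
Hypothesis xb_opt : forall x, f xb + h xb <= f x + h x.

Let cbar : 'rV[R]_n := \row_(i < n) (c 0 i + theta).

(* The default step 0 of [xget] is never used: see [step_minimizer]. *)
Let step (x : 'rV[R]_n) i : R := xget 0 (global_minimizer (major f h c theta i x)).
Let next x i := x + step x i *: basis_vec i.
Let iter u := foldl next x0 u.

(** Minimizers being unique, the run takes the very steps picked by [xget]. *)
Let run_iter w t : X t w = iter (history I t w).
Proof.
have [X0 XS] := X_run w; elim: t => [//|t IH].
have [eta Jeta ->] := XS t.
rewrite /iter /history mkseqS foldl_rcons -/(iter _) -/(history I t w) -IH /next.
congr (_ + _ *: _); rewrite /step; apply/esym/xget_unique => // eta' Jeta'.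
exact: (major_minimizer_unique h_convex theta_gt0 c_ge0 _ _ _ _ Jeta' Jeta).
Qed.

(** Some path has history [rcons u i]: it reaches [iter u], draws [i], and its step there is a
    minimizer, so [xget] finds one. *)
Let step_minimizer u i :
  global_minimizer (major f h c theta i (iter u)) (step (iter u) i).
Proof.
have [w wE] := history_realized I_iid (rcons u i).
move: wE; rewrite size_rcons /history mkseqS => /rcons_inj[uE iE].
have [_ /(_ (size u))[eta + _]] := X_run w.
by rewrite run_iter iE /history uE; exact: xgetI.
Qed.

(** [kappa] will be the inverse of [g xbar], turning gaps of [f + h] into gaps of [F]. *)
Lemma coordinate_descent_rate (kappa : R) t : 0 <= kappa ->
  ('E_P[fun w => (kappa * (f (X t w) + h (X t w) - (f xb + h xb)))%R] <=
   (kappa * n%:R / t.+1%:R * (f x0 + h x0 - (f xb + h xb)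
      + 2^-1 * sqnorm_w cbar (x0 - xb)))%:E)%E.
Proof.
move=> kappa0; pose gap x := f x + h x - (f xb + h xb).
pose dist x := 2^-1 * sqnorm_w cbar (x - xb).
(* The expectation of [phi (X t)] as a finite average over words. *)
pose mean (phi : 'rV[R]_n -> R) t := n%:R^-1 ^+ t * \sum_(u : t.-tuple 'I_n) phi (iter u).
(* The empty word yields a sample point, whose first coordinate shows [n > 0]. *)
have [w _] := history_realized I_iid [::].
have n0 : 0 < n%:R :> R.
  by rewrite ltr0n; exact: leq_ltn_trans (leq0n _) (ltn_ord (I 0%N w)).
have gap0 x : 0 <= gap x by rewrite subr_ge0.
have dist0 x : 0 <= dist x.
  rewrite mulr_ge0// sumr_ge0// => i _; rewrite mxE.
  by rewrite mulr_ge0 ?sqr_ge0// addr_ge0 ?(ltW theta_gt0).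
have mean_ge0 phi s : (forall x, 0 <= phi x) -> 0 <= mean phi s.
  by move=> ?; rewrite mulr_ge0 ?exprn_ge0 ?invr_ge0 ?ler0n ?sumr_ge0.
have mean0 phi : mean phi 0%N = phi x0.
  by rewrite /mean expr0 mul1r (big_pred1 [tuple]) => [//|u]; apply/esym/eqP/tuple0.
have meanD phi psi k s :
    mean (fun x => phi x + k * psi x) s = mean phi s + k * mean psi s.
  by rewrite /mean big_split -mulr_sumr mulrDr mulrCA.
(* Conditioning on the first [s] coordinates: a bound on the average over the next one passes to the
   means. *)
have mean_next phi psi s :
    (forall u, \sum_i phi (next (iter u) i) <= n%:R * psi (iter u)) ->
    mean phi s.+1 <= mean psi s.
  move=> le; rewrite /mean (sum_tuple_rcons _ _ _ (phi \o iter)) exprSr -mulrA.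
  rewrite ler_wpM2l ?exprn_ge0 ?invr_ge0 ?ler0n// ler_pdivrMl// mulr_sumr.
  apply: ler_sum => u _; apply: le_trans (le u).
  by apply: ler_sum => i _; rewrite /iter /= foldl_rcons.
have meanE : ('E_P[fun w => (kappa * (f (X t w) + h (X t w) - (f xb + h xb)))%R])%E
    = (kappa * mean gap t)%:E.
  transitivity ('E_P[fun w => (kappa * gap (iter (history I t w)))%R])%E.
    by congr expectation; apply/funext => w'; rewrite run_iter.
  rewrite (expectation_history I_iid (fun u => kappa * gap (iter u))).
    by rewrite /mean -mulr_sumr mulrCA.
  by move=> u; rewrite mulr_ge0.
rewrite meanE lee_fin -!mulrA ler_wpM2l//.
have k1 : (n%:R : R)^-1 <= 1 by rewrite invf_le1// ler1n -(ltr0n R).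
have mono s : mean gap s.+1 <= mean gap s.
  apply: mean_next => u; rewrite mulr_natl -[n in _ *+ n]card_ord -sumr_const.
  by apply: ler_sum => i _; rewrite lerD2r;
    exact: (obj_minimizer_le theta_gt0 f_smooth _ _ _ (step_minimizer u i)).
have descent s : mean dist s.+1 + mean gap s.+1 <=
    mean dist s + (1 - n%:R^-1) * mean gap s.
  rewrite -[mean gap s.+1]mul1r -!meanD; apply: mean_next => u.
  have -> : n%:R * (dist (iter u) + (1 - n%:R^-1) * gap (iter u)) =
      n%:R * dist (iter u) + (n%:R - 1) * gap (iter u).
    by field; rewrite gt_eqF.
  (* The optimal value leaves the sum [n] times; subtracting it turns [sum_le] into a bound on
     gaps. *)
  have -> : \sum_i (dist (next (iter u) i) + 1 * gap (next (iter u) i)) =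
      \sum_i (dist (next (iter u) i) + (f (next (iter u) i) + h (next (iter u) i)))
        - n%:R * (f xb + h xb).
    rewrite mulr_natl -[n in _ *+ n]card_ord -sumr_const -sumrB.
    by apply: eq_bigr => i _; rewrite mul1r addrA.
  have sum_le : \sum_i (dist (next (iter u) i)
                        + (f (next (iter u) i) + h (next (iter u) i)))
      <= n%:R * dist (iter u) + (n%:R - 1) * (f (iter u) + h (iter u)) + (f xb + h xb).
    exact: (sum_dist_obj_descent h_convex theta_gt0 f_convex f_diff f_smooth
      h_separable _ _ _ (step_minimizer u)).
  by rewrite /gap; lra.
have := descent_rate R (mean gap) (mean dist) _ k1 (mean_ge0 _ ^~ gap0)
  (mean_ge0 _ ^~ dist0) _ mono descent t.
rewrite invr_ge0 ler0n !mean0 => /(_ isT) rate.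
have -> : mean gap t = n%:R * (t.+1%:R^-1 * (t.+1%:R * (n%:R^-1 * mean gap t))).
  by field; rewrite gt_eqF//= gt_eqF.
by rewrite !ler_wpM2l// [X in _ <= X]addrC.
Qed.

End Rate.

(** * The bounds for FCD and PCD *)

Theorem theorem5p17 (R : realType) (n : nat)
  (f h g : 'rV[R]_n -> R) (c : 'rV[R]_n) (theta gbar : R)
  (x0 xbar : 'rV[R]_n)
  (d : measure_display) (Omega : measurableType d) (P : probability Omega R)
  (I : nat -> Omega -> 'I_n) (X : nat -> Omega -> 'rV[R]_n)
  (F := frac_obj f h g)
  (cbar : 'rV[R]_n := \row_(i < n) (c 0 i + theta))
  (q : nat -> Omega -> R := fun t w => F (X t w) - F xbar)
  (q0 : R := F x0 - F xbar)
  (r0 : R := 2^-1 * sqnorm_w cbar (x0 - xbar))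
  (sigma : R := (max_entry c + theta) / theta)
  (numer_ge0 : forall x, 0 <= f x + h x)
  (denom_gt0 : forall x, 0 < g x)
  (f_convex : convex_on_Rn f)
  (f_diff : forall x, differentiable f x)
  (c_ge0 : forall i, 0 <= c 0 i)
  (f_smooth : coordinate_smooth f c)
  (h_convex : convex_on_Rn h)
  (h_separable : separable h)
  (g_concave : concave_on_Rn g)
  (g_diff : forall x, differentiable g x)
  (gbar_gt0 : 0 < gbar)
  (g_le_gbar : forall x, F x <= F x0 -> g x <= gbar)
  (theta_gt0 : 0 < theta)
  (xbar_opt : global_minimizer F xbar)
  (I_iid : iid_uniform P I) :
  (coord_descent_run (fcd_subproblem f h g c theta) x0 I X ->
     forall t, (1 <= t)%N ->
       ('E_P[q t] <= (n%:R * (gbar * sigma * q0 + r0) / (g xbar * t%:R))%:E)%E)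
  /\
  (coord_descent_run (pcd_subproblem f h g c theta) x0 I X ->
     forall t, (1 <= t)%N ->
       ('E_P[q t] <= (n%:R * (gbar * q0 + r0) / (g xbar * (t.+1)%:R))%:E)%E).
Proof.
have g_const := concave_gt0_const g g_concave denom_gt0.
(* [x0] lies in its own sublevel set, and [g] is constant. *)
have gbar_ge x : g x <= gbar by rewrite (g_const x x0); exact: g_le_gbar.
have gE x : f x + h x = g xbar * F x.
  by rewrite /F /frac_obj (g_const x xbar) mulrC divfK ?gt_eqF.
have obj_opt x : f xbar + h xbar <= f x + h x.
  by rewrite !gE ler_pM2l//; exact: xbar_opt.
have q0_ge0 : 0 <= q0 by rewrite subr_ge0; exact: xbar_opt.
have gx0 := denom_gt0 xbar.
have rate t : coord_descent_run (major f h c theta) x0 I X ->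
    ('E_P[q t] <= (n%:R * (gbar * q0 + r0) / (g xbar * (t.+1)%:R))%:E)%E.
  move=> run.
  have -> : q t = fun w =>
      (g xbar)^-1 * (f (X t w) + h (X t w) - (f xbar + h xbar)).
    by apply/funext => w; rewrite !gE -mulrBr mulKf ?gt_eqF.
  apply: le_trans (coordinate_descent_rate f_convex f_diff c_ge0 f_smooth
    h_convex h_separable theta_gt0 I_iid run obj_opt _ _ _) _.
    by rewrite invr_ge0 ltW.
  rewrite lee_fin -/cbar -/r0 !gE -mulrBr -/q0.
  have -> : n%:R * (gbar * q0 + r0) / (g xbar * t.+1%:R)
      = (g xbar)^-1 * n%:R / t.+1%:R * (gbar * q0 + r0).
    by field; rewrite gt_eqF//= gt_eqF.
  rewrite ler_wpM2l ?lerD2r ?ler_wpM2r//.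
  by rewrite !mulr_ge0// invr_ge0 ltW.
have runE sub : (forall i x eta, global_minimizer (sub i x) eta =
    global_minimizer (major f h c theta i x) eta) ->
    coord_descent_run sub x0 I X -> coord_descent_run (major f h c theta) x0 I X.
  move=> subE run w; have [X0 XS] := run w; split=> // t.
  by have [eta] := XS t; rewrite subE; exists eta.
split=> run t t1; last first.
  by apply: rate; apply: runE run => i x eta; exact: pcd_minimizerE.
(* The FCD bound follows from the PCD one, as [sigma >= 1] and [t <= t.+1]; [1 <= t] keeps its
   denominator positive. *)
apply: le_trans (rate t _) _.
  by apply: runE run => i x eta; exact: fcd_minimizerE.
rewrite lee_fin.
have t0 : 0 < t%:R :> R by rewrite ltr0n.
have r0_ge0 : 0 <= r0.
  rewrite mulr_ge0// sumr_ge0// => i _; rewrite mxE.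
  by rewrite mulr_ge0 ?sqr_ge0// addr_ge0 ?(ltW theta_gt0).
have sigma_ge1 : 1 <= sigma.
  by rewrite ler_pdivlMr// mul1r lerDr; exact: bigmax_ge_id.
have gq0_ge0 : 0 <= gbar * q0 by rewrite mulr_ge0// ltW.
apply: ler_pM.
- by rewrite mulr_ge0// addr_ge0.
- by rewrite invr_ge0 mulr_ge0// ltW.
- by rewrite ler_wpM2l// lerD2r mulrAC ler_peMr.
- by rewrite lef_pV2 ?posrE ?mulr_gt0// ler_pM2l// ler_nat.
Qed.
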